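(* Let $\lambda=[\lambda_1,\ldots,\lambda_r]$ be an $\mathrm{EAO}$-partition with $\lambda_1>1$ columns and $r>1$ rows. Then $\lambda$ is a $\mathcal{P}$-position of the game CRIM if and only if $\lambda$ has even rank.
   Context: A partition is a finite weakly decreasing sequence $\lambda=[\lambda_1,\ldots,\lambda_r]$ of positive integers, called its parts; the empty partition $[\,]$ is allowed. Its conjugate is $\lambda'=[\lambda'_1,\ldots,\lambda'_{\lambda_1}]$, where $\lambda'_k$ is the largest $i$ with $\lambda_i\ge k$ (the length of the $k$-th column of the Young diagram). The rank of $\lambda$ is $|r-\lambda_1|$. CRIM is the impartial two-player game whose positions are partitions. From $\lambda=[\lambda_1,\ldots,\lambda_r]$, a row move deletes the part $\lambda_i$ for some $1\le i\le r$, giving $[\lambda_1,\ldots,\lambda_{i-1},\lambda_{i+1},\ldots,\lambda_r]$. A column move takes the conjugate of the partition that results from making a row move on $\lambda'$ (i.e. it removes one column of the Young diagram). Play is normal play: the player to move at the terminal position $[\,]$ loses. A $\mathcal{P}$-position (losing position) is one from which the player who has just moved can force a win; an $\mathcal{N}$-position (winning position) is one from which the player about to move can force a win. A partition $\lambda=[\lambda_1,\ldots,\lambda_r]$ is an $\mathrm{EAO}$-partition (evens-are-odd) if $\lambda_i$ is odd for every even $i\le r$ and $\lambda'_i$ is odd for every even $i\le\lambda_1$. *)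

(* Defs.v *)
From HB Require Import structures.
From mathcomp Require Import all_boot ssrint.

Set Implicit Arguments.
Unset Strict Implicit.
Unset Printing Implicit Defensive.

Definition is_partition (s : seq nat) : bool :=
  sorted geq s && all (fun x => 0 < x) s.

Record intpart := IntPart {
  parts :> seq nat;
  partsP : is_partition parts }.

HB.instance Definition _ := [isSub for parts].
HB.instance Definition _ := [Equality of intpart by <:].

(* Parts are numbered from 1; beyond the last part the value is 0, so that
   [part l 1] is the number of columns even when [l] is empty. *)
Definition part (s : seq nat) (i : nat) : nat := nth 0 s i.-1.

Definition conj_part (s : seq nat) (k : nat) : nat :=
  \max_(1 <= i < (size s).+1 | k <= part s i) i.

Definition conj_seq (s : seq nat) : seq nat :=
  [seq conj_part s k | k <- iota 1 (part s 1)].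

Definition del_seq (s : seq nat) (i : nat) : seq nat :=
  take i.-1 s ++ drop i s.

Lemma conj_seq_is_partition (s : seq nat) : is_partition (conj_seq s).
Proof.
apply/andP; split.
  rewrite /conj_seq sorted_map; apply: sub_sorted (iota_sorted 1 _) => k k' /=.
  move=> le_kk'; rewrite /conj_part [leqRHS]big_mkcond [leqLHS]big_mkcond /=.
  apply: (big_ind2 leq) => [|m m' n n' le_m le_n|i _] //.
    by rewrite geq_max !leq_max le_m le_n orbT.
  by case: (leqP k' (part s i)) => // /(leq_trans le_kk') ->.
apply/allP => x /mapP[k]; rewrite mem_iota add1n ltnS => /andP[k_gt0 le_k] {x}->.
case: s le_k => [|x s le_k]; first by rewrite leqNgt k_gt0.
exact: (@leq_bigmax_seq _ _ _ (fun i => i) 1).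
Qed.

Lemma del_seq_is_partition (s : seq nat) (i : nat) :
  is_partition s -> is_partition (del_seq s i).
Proof.
case/andP => s_sorted s_gt0.
have sub : subseq (del_seq s i) s.
  rewrite -{2}(cat_take_drop i.-1 s); apply: cat_subseq => //.
  by case: i => [|i] //=; rewrite -add1n -drop_drop; apply: drop_subseq.
apply/andP; split.
  by apply: subseq_sorted sub s_sorted => x y z /= yx zy; apply: leq_trans yx.
by apply/allP => x /(mem_subseq sub); apply: (allP s_gt0).
Qed.

Definition conjugate (l : intpart) : intpart :=
  IntPart (conj_seq_is_partition l).

Definition del_part (l : intpart) (i : nat) : intpart :=
  IntPart (del_seq_is_partition i (partsP l)).

Definition rank (l : intpart) : nat := `|size l - part l 1|%N.

Definition row_move (l m : intpart) : Prop :=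
  exists2 i : nat, 1 <= i <= size l & m = del_part l i.

Definition column_move (l m : intpart) : Prop :=
  exists2 u : intpart, row_move (conjugate l) u & m = conjugate u.

Definition crim_move (l m : intpart) : Prop :=
  row_move l m \/ column_move l m.

(* Normal play: a position without moves is a P-position, vacuously.  Being
   inductive, the definition only counts wins forced in finitely many moves. *)
Inductive P_position (T : Type) (move : T -> T -> Prop) (x : T) : Prop :=
  | P_intro of forall y, move x y -> N_position move y
with N_position (T : Type) (move : T -> T -> Prop) (x : T) : Prop :=
  | N_intro y of move x y & P_position move y.

Definition EAO (l : intpart) : Prop :=
  (forall i, 1 <= i <= size l -> ~~ odd i -> odd (part l i)) /\
  (forall i, 1 <= i <= part l 1 -> ~~ odd i -> odd (part (conjugate l) i)).

(* Main.v *)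
(* The proof pairs moves.  For an EAO-partition, deleting the first row is
   answered by deleting the first column (or conversely): the result has even
   rows and columns in all odd positions, and such a partition is a P-position
   because deleting one of the rows 2k-1, 2k can be answered by deleting the
   other.  The remaining rows of an EAO-partition are paired as (2,3), (4,5), ...;
   if there is an even number of rows, hence also of columns in the even rank
   case, the last row is paired with the last column.  These answers preserve the
   class unless they leave fewer than two rows or columns; in those cases the
   position moved to is a single row or a pair of rows, or the partition is a
   hook with two columns.  From odd rank, one moves to even rank by deleting the
   last column, or the last row of such a hook. *)

Require Import Defs.
From mathcomp Require Import all_boot zify.

Set Implicit Arguments.
Unset Strict Implicit.
Unset Printing Implicit Defensive.

(** Structural recursion on the derivation of [P_position], two moves at a time: the winning reply
    stored in it carries a smaller derivation. *)
Lemma P_N_exclusive (T : Type) (move : T -> T -> Prop) :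
  forall x, P_position move x -> N_position move x -> False.
Proof.
fix IH 2 => x [Px] [y xy [Py]].
by case: (Px y xy) => z yz Pz; apply: (IH z Pz); apply: Py.
Qed.

(* Rows and columns are numbered from 0 from here on. *)
Definition row_len (l : intpart) (i : nat) : nat := nth 0 l i.
Definition col_len (l : intpart) (j : nat) : nat := nth 0 (conjugate l) j.
Definition del_row (l : intpart) (i : nat) : intpart := del_part l i.+1.
Definition del_col (l : intpart) (j : nat) : intpart :=
  conjugate (del_row (conjugate l) j).

(** * Row and column lengths under conjugation and deletion *)

Lemma nth_partition_mono (s : seq nat) (i j : nat) :
  is_partition s -> i <= j -> nth 0 s j <= nth 0 s i.
Proof.
case/andP=> s_sorted _ le_ij; case: (ltnP j (size s)) => [lt_js|ge_js]; last first.
  by rewrite nth_default.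
have geq_trans : transitive geq by move=> x y z /= yx zy; apply: leq_trans yx.
exact: (sorted_leq_nth geq_trans leqnn 0 s_sorted) (leq_ltn_trans le_ij lt_js) lt_js le_ij.
Qed.

(** Both sides say that the cell in row [i] and column [j] lies in the Young diagram. *)
Lemma row_col_len (l : intpart) (i j : nat) : (j < row_len l i) = (i < col_len l j).
Proof.
rewrite /row_len /col_len /= /conj_seq; case: l => s s_part /=.
have le0 := @nth_partition_mono s 0 _ s_part.
case: (ltnP j (part s 1)) => [lt_j|ge_j]; last first.
  rewrite [in RHS]nth_default ?size_map ?size_iota // ltn0.
  by apply/negbTE; rewrite -leqNgt (leq_trans (le0 i _)).
rewrite (nth_map 0) ?size_iota // nth_iota // add1n /conj_part.
apply/idP/idP => [lt_ji|].
  apply: (@leq_bigmax_seq _ _ _ (fun i => i) i.+1) => //.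
  rewrite mem_index_iota /= ltnS ltnNge; apply/negP => ge_i.
  by rewrite nth_default in lt_ji.
apply: contraTT; rewrite -!leqNgt => le_ij.
apply/bigmax_leqP_seq => [[|k] _] //= lt_jk.
rewrite leqNgt; apply/negP; rewrite ltnS => le_ik.
by move: lt_jk; rewrite /part /= ltnNge (leq_trans (nth_partition_mono s_part le_ik)).
Qed.

(** Positivity of the parts lets the zero-padded row lengths determine the number of rows. *)
Lemma eq_row_len (l m : intpart) : (forall i, row_len l i = row_len m i) -> l = m.
Proof.
move=> eq_lm; apply: val_inj => /=.
have size_le (u v : intpart) : (forall i, row_len u i = row_len v i) -> size u <= size v.
  move=> uv; rewrite leqNgt; apply/negP => lt_vu.
  have /andP[_ /allP/(_ _ (mem_nth 0 lt_vu))] := partsP u.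
  by have := uv (size v); rewrite /row_len => ->; rewrite nth_default.
apply: (@eq_from_nth _ 0) => [|i _]; last exact: eq_lm.
by apply/eqP; rewrite eqn_leq !size_le.
Qed.

Lemma row_len_conj (l : intpart) (j : nat) : row_len (conjugate l) j = col_len l j.
Proof. by []. Qed.

Lemma eq_ltn (m n : nat) : (forall k, (k < m) = (k < n)) -> m = n.
Proof.
by move=> eq_mn; have := eq_mn m; have := eq_mn n; lia.
Qed.

Lemma col_len_conj (l : intpart) (i : nat) : col_len (conjugate l) i = row_len l i.
Proof. by apply: eq_ltn => j; rewrite -row_col_len row_len_conj -row_col_len. Qed.

Lemma conjugateK : involutive conjugate.
Proof. by move=> l; apply: eq_row_len => i; rewrite row_len_conj col_len_conj. Qed.

Lemma size_col_len (l : intpart) : size l = col_len l 0.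
Proof.
apply: eq_ltn => i; rewrite -row_col_len /row_len.
have /andP[_ /allP l_gt0] := partsP l.
case: (ltnP i (size l)) => [lt_il|ge_il]; last by rewrite nth_default.
by apply/esym/l_gt0/mem_nth.
Qed.

Lemma row_len_del_row (l : intpart) (r i : nat) :
  row_len (del_row l r) i = row_len l (bump r i).
Proof.
rewrite /row_len /= /del_seq /= nth_cat size_take nth_drop /bump.
case: (ltnP r (size l)) => [lt_rl|ge_rl].
  case: (ltnP i r) => [lt_ir|le_ri]; first by rewrite nth_take.
  by congr nth; lia.
case: (ltnP i (size l)) => [lt_il|ge_il].
  by rewrite nth_take; [congr nth; lia | lia].
by rewrite !nth_default //; lia.
Qed.

(** A column loses a cell exactly when it reaches row [r]; [unbump r] subtracts that cell. *)
Lemma col_len_del_row (l : intpart) (r j : nat) :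
  col_len (del_row l r) j = unbump r (col_len l j).
Proof.
apply: eq_ltn => i; rewrite -row_col_len row_len_del_row row_col_len /bump /unbump.
lia.
Qed.

Lemma row_len_del_col (l : intpart) (c i : nat) :
  row_len (del_col l c) i = unbump c (row_len l i).
Proof. by rewrite row_len_conj col_len_del_row col_len_conj. Qed.

Lemma col_len_del_col (l : intpart) (c j : nat) :
  col_len (del_col l c) j = col_len l (bump c j).
Proof. by rewrite col_len_conj row_len_del_row row_len_conj. Qed.

Definition len_del :=
  (row_len_del_row, col_len_del_row, row_len_del_col, col_len_del_col).

Lemma row_len0_max (l : intpart) (i : nat) : row_len l i <= row_len l 0.
Proof. exact: nth_partition_mono (partsP l) _. Qed.

Lemma col_len0_max (l : intpart) (j : nat) : col_len l j <= col_len l 0.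
Proof. exact: row_len0_max (conjugate l) j. Qed.

Lemma row_len_bump_last (l : intpart) (i : nat) :
  row_len l (bump (col_len l 0).-1 i) =
    if i < (col_len l 0).-1 then row_len l i else 0.
Proof.
case: ltnP => [lt_i|ge_i]; first by congr row_len; rewrite /bump; lia.
have := row_col_len l (bump (col_len l 0).-1 i) 0.
have : col_len l 0 <= bump (col_len l 0).-1 i by rewrite /bump; lia.
by lia.
Qed.

Lemma col_len_bump_last (l : intpart) (j : nat) :
  col_len l (bump (row_len l 0).-1 j) =
    if j < (row_len l 0).-1 then col_len l j else 0.
Proof. by have := row_len_bump_last (conjugate l) j; rewrite col_len_conj. Qed.

(** * Moves and their symmetry under conjugation *)

Local Notation P := (P_position crim_move).
Local Notation N := (N_position crim_move).

Lemma crim_moveP (l m : intpart) :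
  crim_move l m <->
    (exists2 r, r < col_len l 0 & m = del_row l r) \/
    (exists2 c, c < row_len l 0 & m = del_col l c).
Proof.
have row_moveP u v :
    row_move u v <-> exists2 r, r < col_len u 0 & v = del_row u r.
  rewrite -size_col_len; split=> [[[|r] // lt_r ->]|[r lt_r ->]].
    by exists r.
  by exists r.+1.
split=> [[/row_moveP|[u /row_moveP[c lt_c ->] ->]]|[/row_moveP|[c lt_c ->]]].
- by left.
- by right; exists c; rewrite -?col_len_conj.
- by left.
- right; exists (del_row (conjugate l) c) => //.
  by apply/row_moveP; exists c; rewrite ?col_len_conj.
Qed.

Lemma N_del_row (l : intpart) (r : nat) :
  r < col_len l 0 -> P (del_row l r) -> N l.
Proof. by move=> lt_r; apply: N_intro; apply/crim_moveP; left; exists r. Qed.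

Lemma N_del_col (l : intpart) (c : nat) :
  c < row_len l 0 -> P (del_col l c) -> N l.
Proof. by move=> lt_c; apply: N_intro; apply/crim_moveP; right; exists c. Qed.

Lemma crim_move_conj (l m : intpart) :
  crim_move l m -> crim_move (conjugate l) (conjugate m).
Proof.
case/crim_moveP=> [] [k lt_k ->]; apply/crim_moveP.
  by right; exists k; rewrite /del_col ?conjugateK.
by left; exists k; rewrite /del_col ?conjugateK ?col_len_conj.
Qed.

Lemma P_conj_N_conj :
  (forall l, P l -> P (conjugate l)) /\ (forall l, N l -> N (conjugate l)).
Proof.
have P_conj : forall l, P l -> P (conjugate l).
  fix IH 2 => l [Pl]; split=> m /crim_move_conj; rewrite conjugateK => /Pl[u mu Pu].
  apply: (N_intro (y := conjugate u)); last exact: IH.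
  by rewrite -(conjugateK m); apply: crim_move_conj.
split=> // l [m lm Pm]; apply: (N_intro (y := conjugate m)); last exact: P_conj.
exact: crim_move_conj.
Qed.

(* Odd-positioned rows and columns are even: positions start at 0 here. *)
Definition OAE (l : intpart) : Prop :=
  forall i, ~~ odd i -> ~~ odd (row_len l i) /\ ~~ odd (col_len l i).

Lemma OAE_conj (l : intpart) : OAE l -> OAE (conjugate l).
Proof. by move=> hl i /hl[]; rewrite row_len_conj col_len_conj. Qed.

Lemma OAE_P (l : intpart) : OAE l -> P l.
Proof.
have [n] := ubnP (row_len l 0 + col_len l 0); elim: n l => // n IHn l le_n hl.
suff row_N u r : row_len u 0 + col_len u 0 < n.+1 -> OAE u ->
    r < col_len u 0 -> N (del_row u r).
  split=> m /crim_moveP[[r lt_r ->]|[c lt_c ->]]; first exact: row_N.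
  apply: (proj2 P_conj_N_conj); apply: row_N; last by rewrite col_len_conj.
    by rewrite col_len_conj row_len_conj addnC.
  exact: OAE_conj.
move=> {}le_n {}hl lt_r.
have [_ even_size] := hl 0 isT.
(* Rows [2k] and [2k+1] are partners; whichever is deleted, the other then has index [2k]. It exists
   because the number of rows is even. *)
apply: (@N_del_row _ (r - odd r)).
  by rewrite len_del /unbump; lia.
apply: IHn.
  have := row_len0_max u (bump r (bump (r - odd r) 0)).
  by rewrite !len_del /unbump; lia.
move=> i even_i; rewrite !len_del; split.
  by have /hl[] : ~~ odd (bump r (bump (r - odd r) i)) by rewrite /bump; lia.
(* A column of even height meets both partners or neither. *)
by have [_] := hl i even_i; rewrite /unbump; lia.
Qed.

(** * Positions with one or two rows *)

Lemma one_row_N (l : intpart) : col_len l 0 = 1 -> N l.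
Proof.
move=> one_row; apply: (@N_del_row _ 0); first by rewrite one_row.
apply: OAE_P => i _; rewrite !len_del.
have := row_col_len l (bump 0 i) 0; have := col_len0_max l i.
by rewrite one_row /bump /unbump; lia.
Qed.

(** From an odd number of columns, deleting the last one leaves an even two-row position or nothing.
    From an even number, every move leaves a single row or an odd two-row position. *)
Lemma two_rows (l : intpart) : col_len l 0 = 2 ->
  (odd (row_len l 0) -> N l) /\ (~~ odd (row_len l 0) -> P l).
Proof.
have [n] := ubnP (row_len l 0); elim: n l => // n IHn l le_n two.
have row_gt0 : 0 < row_len l 0 by rewrite row_col_len two.
split=> [odd_row|even_row].
  case: (ltnP 1 (row_len l 0)) => [row_gt1|row_le1].
    have c0 : bump (row_len l 0).-1 0 = 0 by rewrite /bump; lia.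
    apply: (@N_del_col _ (row_len l 0).-1); first by lia.
    by apply IHn; rewrite !len_del ?c0 /unbump; lia.
  apply: (@N_del_col _ 0) => //.
  apply: OAE_P => i _; rewrite !len_del.
  have := row_col_len l 0 (bump 0 i); have := row_len0_max l i.
  by rewrite /bump /unbump; lia.
split=> m /crim_moveP[[r lt_r ->]|[c lt_c ->]].
  by apply: one_row_N; rewrite len_del /unbump; lia.
case: (eqVneq (col_len (del_col l c) 0) 1) => [/one_row_N//|not_one].
apply IHn; rewrite !len_del; try by rewrite /unbump; lia.
move: not_one; rewrite len_del.
have := row_col_len l 0 1; have := col_len0_max l (bump c 0).
case: (posnP c) => [-> | c_gt0]; first by rewrite (_ : bump 0 0 = 1) //; lia.
by rewrite (_ : bump c 0 = 0) //; rewrite /bump; lia.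
Qed.

(* Since [0.-1 = 0], a row or column beyond the last one satisfies the
   condition. *)
Definition EAO_len (l : intpart) : Prop :=
  forall i, odd i -> ~~ odd (row_len l i).-1 /\ ~~ odd (col_len l i).-1.

(** * EAO-partitions of even and odd rank *)

Lemma EAO_lenP (l : intpart) : EAO l -> EAO_len l.
Proof.
case=> row_odd col_odd i odd_i; split.
  case: (ltnP i (size l)) => [lt_i|ge_i]; last by rewrite /row_len nth_default.
  by have := row_odd i.+1 _ _; rewrite /part -/(row_len l i) /=; lia.
case: (ltnP i (row_len l 0)) => [lt_i|ge_i]; last first.
  by have := row_col_len l 0 i; lia.
by have := col_odd i.+1 _ _; rewrite /part -/(row_len l 0) -/(col_len l i) /=; lia.
Qed.

Lemma EAO_len_conj (l : intpart) : EAO_len l -> EAO_len (conjugate l).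
Proof. by move=> hl i /hl[]; rewrite row_len_conj col_len_conj. Qed.

(** The induction hypothesis, named so that the analysis of row deletions serves both a partition
    and its conjugate. *)
Definition even_EAO_P_upto (n : nat) : Prop :=
  forall l, row_len l 0 + col_len l 0 < n -> EAO_len l ->
    1 < row_len l 0 -> 1 < col_len l 0 ->
    ~~ odd (row_len l 0 + col_len l 0) -> P l.

(** The second row has length at most 2, and the parity condition brings this down to at most 1. *)
Lemma EAO_len_hook (l : intpart) :
  EAO_len l -> row_len l 0 = 2 -> 1 < col_len l 0 ->
  forall j, odd j -> col_len l j <= 1.
Proof.
move=> hl row2 gt1 j odd_j; rewrite leqNgt -row_col_len -leqNgt.
have := row_len0_max l 1; have [+ _] := hl 1 isT; lia.
Qed.

Lemma even_EAO_del_row_N (n : nat) (l : intpart) (r : nat) :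
  even_EAO_P_upto n -> row_len l 0 + col_len l 0 < n.+1 -> EAO_len l ->
  1 < row_len l 0 -> 1 < col_len l 0 ->
  ~~ odd (row_len l 0 + col_len l 0) -> r < col_len l 0 -> N (del_row l r).
Proof.
move=> IHn le_n hl row_gt1 col_gt1 even_l lt_r.
case: (posnP r) => [-> {r lt_r}|r_gt0].
  apply: (@N_del_col _ 0).
    by rewrite len_del /bump row_col_len.
  (* Losing the first row and column shifts positions and lengths by one, which turns [EAO_len] into
     [OAE]. *)
  apply: OAE_P => i even_i; rewrite !len_del.
  have /hl : odd (bump 0 i) by rewrite /bump; lia.
  by rewrite /unbump; lia.
have row_len_del0 : row_len (del_row l r) 0 = row_len l 0.
  by rewrite len_del (_ : bump r 0 = 0) // /bump; lia.
have col_len_del0 : col_len (del_row l r) 0 = (col_len l 0).-1.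
  by rewrite len_del /unbump; lia.
case: (eqVneq (col_len l 0) 2) => [two|ne2].
  by apply: one_row_N; rewrite col_len_del0 two.
case: (eqVneq (col_len l 0) 3) => [three|ne3].
  (* Even rank makes the number of columns odd here. *)
  by apply two_rows; rewrite ?row_len_del0 ?col_len_del0; lia.
case: (ltnP (r + odd r) (col_len l 0)) => [paired|unpaired].
  (* The index, after the deletion of [r], of its partner in the pairs (1,2), (3,4), ... counted
     from 0. *)
  pose p := r - ~~ odd r.
  apply: (@N_del_row _ p); first by rewrite col_len_del0; lia.
  have row0 : bump r (bump p 0) = 0 by rewrite /bump /p; lia.
  apply: IHn; rewrite ?len_del ?row0 /unbump; try (rewrite /p; lia).
  move=> i odd_i; rewrite !len_del; split.
    by have /hl[] : odd (bump r (bump p i)) by rewrite /bump /p; lia.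
  (* A nonempty column at an odd position has odd height: it consists of row 0 and whole pairs. *)
  by have [_] := hl i odd_i; rewrite /unbump /p; lia.
have odd_r : odd r by lia.
(* With two columns, deleting the last would leave only one. In this hook, deleting another lower
   row does not touch the second column. *)
case: (eqVneq (row_len l 0) 2) => [row2|row_ne2].
  apply: (@N_del_row _ r.-1); first by rewrite col_len_del0; lia.
  have row0 : bump r (bump r.-1 0) = 0 by rewrite /bump; lia.
  apply: IHn; rewrite ?len_del ?row0 /unbump; try lia.
  move=> i odd_i; rewrite !len_del; split.
    case: (ltnP i r.-1) => [lt_i|ge_i].
      have -> : bump r (bump r.-1 i) = i by rewrite /bump; lia.
      by have [] := hl i odd_i.
    have := row_col_len l (bump r (bump r.-1 i)) 0.
    have : col_len l 0 <= bump r (bump r.-1 i) by rewrite /bump; lia.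
    by lia.
  by have := EAO_len_hook hl row2 col_gt1 odd_i; rewrite /unbump; lia.
have even_row : ~~ odd (row_len l 0) by lia.
have last_r : r = (col_len l 0).-1 by lia.
apply: (@N_del_col _ (row_len l 0).-1); first by rewrite row_len_del0; lia.
have r0 : bump r 0 = 0 by rewrite /bump; lia.
have c0 : bump (row_len l 0).-1 0 = 0 by rewrite /bump; lia.
apply: IHn; rewrite ?len_del ?r0 ?c0 /unbump; try lia.
move=> i odd_i; rewrite !len_del; split.
  (* The first row is even, so the odd rows at odd positions are strictly shorter and miss the last
     column. *)
  rewrite last_r row_len_bump_last; have := row_len0_max l i.
  by have := hl i odd_i; rewrite /unbump; case: ifP => _; lia.
rewrite col_len_bump_last; have := col_len0_max l i.
by have := hl i odd_i; rewrite /unbump; case: ifP => _; lia.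
Qed.

Lemma even_EAO_P (l : intpart) : EAO_len l ->
  1 < row_len l 0 -> 1 < col_len l 0 ->
  ~~ odd (row_len l 0 + col_len l 0) -> P l.
Proof.
have [n] := ubnP (row_len l 0 + col_len l 0).
elim: n l => // n IHn l le_n hl row_gt1 col_gt1 even_l.
split=> m /crim_moveP[[r lt_r ->]|[c lt_c ->]].
  exact: (even_EAO_del_row_N (n := n)).
apply: (proj2 P_conj_N_conj); apply: (even_EAO_del_row_N IHn).
- by rewrite row_len_conj col_len_conj addnC.
- exact: EAO_len_conj.
- by rewrite row_len_conj.
- by rewrite col_len_conj.
- by rewrite row_len_conj col_len_conj addnC.
- by rewrite col_len_conj.
Qed.

Lemma odd_EAO_N (l : intpart) : EAO_len l ->
  1 < row_len l 0 -> 1 < col_len l 0 ->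
  odd (row_len l 0 + col_len l 0) -> N l.
Proof.
(* Odd rank makes exactly one of the two dimensions even; conjugation makes it the number of
   columns. *)
wlog even_row : l / ~~ odd (row_len l 0).
  move=> wlog_l hl row_gt1 col_gt1 odd_l.
  have [odd_row|] := boolP (odd (row_len l 0)); last by move/wlog_l; apply.
  rewrite -(conjugateK l); apply: (proj2 P_conj_N_conj).
  apply: wlog_l; rewrite ?row_len_conj ?col_len_conj; try lia.
  exact: EAO_len_conj.
move=> hl row_gt1 col_gt1 odd_l.
have [row2|row_ne2] := eqVneq (row_len l 0) 2.
  apply: (@N_del_row _ (col_len l 0).-1); first by lia.
  have r0 : bump (col_len l 0).-1 0 = 0 by rewrite /bump; lia.
  apply: even_EAO_P; rewrite ?len_del ?r0 /unbump; try lia.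
  move=> i odd_i; rewrite !len_del; split; last first.
    by have := EAO_len_hook hl row2 col_gt1 odd_i; rewrite /unbump; lia.
  by rewrite row_len_bump_last; case: ifP => // _; have [] := hl i odd_i.
apply: (@N_del_col _ (row_len l 0).-1); first by lia.
have c0 : bump (row_len l 0).-1 0 = 0 by rewrite /bump; lia.
apply: even_EAO_P; rewrite ?len_del ?c0 /unbump; try lia.
move=> i odd_i; rewrite !len_del; split.
  by have := row_len0_max l i; have := hl i odd_i; rewrite /unbump; lia.
by rewrite col_len_bump_last; case: ifP => // _; have [] := hl i odd_i.
Qed.

Lemma odd_rank (l : intpart) : odd (rank l) = odd (row_len l 0 + col_len l 0).
Proof. by rewrite /rank size_col_len /part -/(row_len l 0); lia. Qed.

Theorem theorem2 (l : intpart) (hEAO : EAO l)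
  (hcols : 1 < part l 1) (hrows : 1 < size l) :
  P_position crim_move l <-> ~~ odd (rank l).
Proof.
have hl := EAO_lenP hEAO; rewrite size_col_len in hrows; rewrite odd_rank.
split=> [Pl|]; last exact: even_EAO_P.
by apply/negP => /(odd_EAO_N hl hcols hrows) /(P_N_exclusive Pl).
Qed.
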